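(* Let $c\colon X\rightsquigarrow Y$ be a channel, let $\omega\in\mathcal{D}(X)$, and let $\psi\in\mathcal{M}(Y)$ be a multiset of size $K=\|\psi\|\geq1$. Then \[ \mathrm{flrn}_*\Big(\mathrm{mn}[K](\omega)\big|_{\mathcal{M}[K](c)^*\mathbf{1}_\psi}\Big)=c^\dagger_\omega{}_*\,\mathrm{flrn}(\psi). \]
   Context: Distributions and multisets. \begin{itemize} \item $\mathcal{D}(X)$ denotes finitely supported probability distributions. \item $\mathcal{M}(X)$ denotes finitely supported multisets $\varphi\colon X\to\mathbb{N}$, with size $\|\varphi\|=\sum_x\varphi(x)$. \item $\mathcal{M}[K](X)$ is the set of multisets of size $K$. \item $\mathrm{flrn}(\varphi)(x)=\varphi(x)/\|\varphi\|$. It is regarded as a function $\mathcal{M}[K](X)\to\mathcal{D}(X)$, i.e.\ a channel. \item The multinomial distribution is \[ \mathrm{mn}[K](\omega)(\varphi)=\frac{K!}{\prod_x\varphi(x)!}\prod_x\omega(x)^{\varphi(x)}. \] \end{itemize} Channels. \begin{itemize} \item A channel $c\colon X\rightsquigarrow Y$ is a function $X\to\mathcal{D}(Y)$. \item The pushforward is $(c_*\omega)(y)=\sum_x\omega(x)c(x)(y)$, and a function $f$ pushes forward as the channel $x\mapsto 1|f(x)\rangle$. \item Kleisli composition is $(d\circ c)(x)=d_*(c(x))$. \end{itemize} Extended multiset functor. $\mathcal{M}[K](c)\colon\mathcal{M}[K](X)\rightsquigarrow\mathcal{M}[K](Y)$ is the Kleisli composite $\mathrm{acc}\circ c^K\circ\mathrm{arr}$,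 where: \begin{itemize} \item $c^K(x_1,\dots,x_K)(y_1,\dots,y_K)=\prod_i c(x_i)(y_i)$; \item $\mathrm{acc}(x_1,\dots,x_K)=\sum_i1|x_i\rangle$; \item $\mathrm{arr}(\varphi)$ is the uniform distribution on $\mathrm{acc}^{-1}(\varphi)$, each element having probability $\prod_x\varphi(x)!/K!$. \end{itemize} Predicates. \begin{itemize} \item $\mathbf{1}_\psi$ is the point predicate at $\psi$ on $\mathcal{M}[K](Y)$. \item The pullback of a predicate $q$ is $(d^*q)(a)=\sum_b d(a)(b)q(b)$. \item Conditioning of $\sigma$ by a predicate $p$ with $\sum_a\sigma(a)p(a)\neq0$ is $\sigma|_p(a)=\sigma(a)p(a)/\sum_{a'}\sigma(a')p(a')$. \end{itemize} Dagger. $c^\dagger_\omega\colon Y\rightsquigarrow X$ is \[ c^\dagger_\omega(y)(x)=\frac{\omega(x)c(x)(y)}{(c_*\omega)(y)}, \] and $c^\dagger_\omega{}_*\,\mathrm{flrn}(\psi)$ is Jeffrey's update of $\omega$ with evidence $\mathrm{flrn}(\psi)$. *)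

(* Defs.v *)
From HB Require Import structures.
From mathcomp Require Import all_boot all_order all_algebra finmap multiset.
From mathcomp Require Import boolp classical_sets functions cardinality fsbigop.
From mathcomp Require Import reals.

Set Implicit Arguments.
Unset Strict Implicit.
Unset Printing Implicit Defensive.

Import Order.TTheory GRing.Theory Num.Theory.
Local Open Scope classical_set_scope.
Local Open Scope ring_scope.
Local Open Scope mset_scope.

Definition is_dist (R : realType) (X : choiceType) (f : X -> R) : Prop :=
  [/\ forall x, 0 <= f x,
      finite_set [set x | f x != 0]
    & \sum_(x \in [set: X]) f x = 1].

Record dist (R : realType) (X : choiceType) := Dist {
  dist_fun :> X -> R;
  distP : is_dist dist_fun }.

Definition channel (R : realType) (X Y : choiceType) := X -> dist R Y.

Section Sums.
Variable R : realType.
Implicit Types X Y : choiceType.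

Lemma dist_ge0 X (d : dist R X) x : 0 <= d x.
Proof. by case: (distP d). Qed.

Lemma dist_fin X (d : dist R X) : finite_set [set x | d x != 0].
Proof. by case: (distP d). Qed.

Lemma dist_sum1 X (d : dist R X) : \sum_(x \in [set: X]) d x = 1.
Proof. by case: (distP d). Qed.

Lemma dist_ext X (d e : dist R X) : d =1 e -> d = e.
Proof.
case: d e => [f f0] [g g0] /= /funext fg.
by move: f0; rewrite fg => f0; congr Dist; exact: Prop_irrelevance.
Qed.

Lemma fsumE X (f : X -> R) (s : seq X) : uniq s ->
  (forall x, f x != 0 -> x \in s) ->
  \sum_(x \in [set: X]) f x = \sum_(x <- s) f x.
Proof.
move=> us sf; rewrite [RHS]fsbig_seq//; apply/esym/fsbig_widen => //.
move=> x [_ /= xs]; apply: contrapT => /eqP/sf; exact: xs.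
Qed.

Lemma is_dist_seq X (f : X -> R) (s : seq X) : uniq s ->
  (forall x, 0 <= f x) -> (forall x, f x != 0 -> x \in s) ->
  \sum_(x <- s) f x = 1 -> is_dist f.
Proof.
move=> us f0 sf sf1; split=> //; last by rewrite (fsumE us).
exact: (sub_finite_set _ (finite_seq s)).
Qed.

Lemma is_dist_eq X (f : X -> R) (d : dist R X) : f =1 d -> is_dist f.
Proof. by move=> /funext->; exact: distP. Qed.

Definition supp X (d : dist R X) : {fset X} := fset_set [set x | d x != 0].

Lemma suppP X (d : dist R X) x : (x \in supp d) = (d x != 0).
Proof.
by rewrite in_fset_set; [apply/idP/idP; rewrite inE | exact: dist_fin].
Qed.

Lemma sum_dist X (d : dist R X) (s : seq X) : uniq s ->
  (forall x, d x != 0 -> x \in s) -> \sum_(x <- s) d x = 1.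
Proof. by move=> us sd; rewrite -(fsumE us)// dist_sum1. Qed.

Lemma expect_supp X (d : dist R X) (q : X -> R) :
  \sum_(x \in [set: X]) d x * q x = \sum_(x <- supp d) d x * q x.
Proof.
rewrite (fsumE (fset_uniq (supp d)))// => x; rewrite suppP.
by apply: contraNneq => ->; rewrite mul0r.
Qed.

Lemma dirac_is_dist X (x : X) : is_dist (fun y => (y == x)%:R : R).
Proof.
apply: (@is_dist_seq _ _ [:: x]) => //; last by rewrite big_seq1 eqxx.
by move=> y; rewrite inE; case: (y == x) => //=; rewrite mulr0n eqxx.
Qed.

Lemma push_is_dist X Y (c : channel R X Y) (w : dist R X) :
  is_dist (fun y => \sum_(x \in [set: X]) w x * c x y).
Proof.
pose s := undup (flatten [seq (supp (c x) : seq Y) | x <- supp w]).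
have us : uniq s by rewrite undup_uniq.
have Hs x y : w x != 0 -> c x y != 0 -> y \in s.
  move=> wx cxy; rewrite mem_undup; apply/flatten_mapP.
  by exists x; rewrite suppP.
apply: (is_dist_seq us) => [y|y|].
- by apply: fsumr_ge0 => x _; rewrite mulr_ge0// dist_ge0.
- rewrite expect_supp; apply: contraR => ys; apply/eqP; rewrite big_seq big1//.
  move=> x; rewrite suppP => wx; have [->|cxy] := eqVneq (c x y) 0.
    by rewrite mulr0.
  by move: ys; rewrite (Hs x).
under eq_bigr do rewrite expect_supp.
rewrite exchange_big /= -(@sum_dist _ w (supp w)) ?fset_uniq//; last first.
  by move=> x; rewrite suppP.
rewrite big_seq [RHS]big_seq; apply: eq_bigr => x; rewrite suppP => wx.
by rewrite -mulr_sumr (sum_dist us) ?mulr1// => y; apply: Hs.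
Qed.

Lemma iprod_is_dist Y K (d : 'I_K -> dist R Y) :
  is_dist (fun u : K.-tuple Y => \prod_(i < K) d i (tnth u i)).
Proof.
pose S := [fset y in flatten [seq (supp (d i) : seq Y) | i <- enum 'I_K]]%fset.
have HS i y : d i y != 0 -> y \in S.
  move=> diy; rewrite inE; apply/flatten_mapP.
  by exists i; rewrite ?mem_enum// suppP.
pose s := [seq map_tuple (val : S -> Y) u | u <- enum {: K.-tuple S}].
have us : uniq s.
  rewrite map_inj_uniq ?enum_uniq// => u v /(congr1 val)/= uv.
  by apply: val_inj; apply: inj_map uv; exact: val_inj.
apply: (is_dist_seq us) => [u|u|].
- by apply: prodr_ge0 => i _; exact: dist_ge0.
- move=> /prodf_neq0 Hu.
  have uS i : tnth u i \in S by apply: HS; exact: Hu.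
  apply/mapP; exists [tuple [` uS i]%fset | i < K]; first by rewrite mem_enum.
  by apply: eq_from_tnth => i; rewrite tnth_map tnth_mktuple.
rewrite big_map big_enum /=.
transitivity (\sum_(g : {ffun 'I_K -> S}) \prod_(i < K) d i (val (g i))).
  rewrite (reindex (fun g : {ffun 'I_K -> S} => [tuple g i | i < K])) /=; last first.
    exists (fun u => [ffun i => tnth u i]) => [g _|u _].
      by apply/ffunP => i; rewrite ffunE tnth_mktuple.
    by apply: eq_from_tnth => i; rewrite tnth_mktuple ffunE.
  apply: eq_bigr => g _; apply: eq_bigr => i _.
  by rewrite tnth_map tnth_mktuple.
rewrite -(bigA_distr_bigA (fun i (y : S) => d i (val y))) big1// => i _.
rewrite -(big_seq_fsetE _ _ xpredT (d i)) /=.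
by rewrite sum_dist// => y; apply: HS.
Qed.

End Sums.

Definition dirac (R : realType) (X : choiceType) (x : X) : dist R X :=
  @Dist R X (fun y => (y == x)%:R) (dirac_is_dist R x).

Definition fchan (R : realType) (X Y : choiceType) (f : X -> Y) :
  channel R X Y := fun x => dirac R (f x).

Definition push (R : realType) (X Y : choiceType) (c : channel R X Y)
    (w : dist R X) : dist R Y :=
  @Dist R Y (fun y => \sum_(x \in [set: X]) w x * c x y) (push_is_dist c w).

Definition kcomp (R : realType) (X Y Z : choiceType) (d : channel R Y Z)
  (c : channel R X Y) : channel R X Z := fun x => push d (c x).

Definition msize (X : choiceType) (phi : {mset X}) : nat :=
  (\sum_(x <- finsupp phi) phi x)%N.

Definition msetK (K : nat) (X : choiceType) := {phi : {mset X} | msize phi == K}.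

HB.instance Definition _ K X := Choice.on (msetK K X).

(* Factors off the support are 0! = 1. *)
Definition mfact (X : choiceType) (phi : {mset X}) : nat :=
  (\prod_(x <- finsupp phi) (phi x)`!)%N.

Section Multisets.
Variable X : choiceType.
Implicit Types (phi : {mset X}) (s : seq X).

Lemma msizeE phi : msize phi = size phi.
Proof.
by rewrite -sum1_size sum_mset /msize; apply: eq_bigr => x _; rewrite muln1.
Qed.

Lemma msize_seq s : msize (seq_mset s) = size s.
Proof. by rewrite msizeE (perm_size (perm_eq_seq_mset s)). Qed.

Lemma prod_countE (A : seq X) s : uniq A -> {subset s <= A} ->
  (\prod_(x <- undup s) (count_mem x s)`! = \prod_(x <- A) (count_mem x s)`!)%N.
Proof.
move=> uA sA; rewrite [RHS](bigID (mem s)) /= [X in (_ * X)%N]big1 ?muln1.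
  rewrite -[RHS]big_filter; apply: perm_big; apply: uniq_perm.
  - exact: undup_uniq.
  - exact: filter_uniq.
  move=> x; rewrite mem_undup mem_filter; case: (boolP (x \in s)) => //= /sA->//.
by move=> x /count_memPn->.
Qed.

Lemma size_permutations_fact s :
  (\prod_(x <- undup s) (count_mem x s)`! * size (permutations s)
     = (size s)`!)%N.
Proof.
move: {2}(size s) (erefl (size s)) => n; elim: n s => [|n IHn] s Dn.
  by case: s Dn => // _; rewrite /= big_nil.
rewrite (perm_size (permutationsE _)) ?Dn// size_allpairs_dep sumn_map big_distrr.
rewrite /= big_seq.
transitivity (\sum_(x <- undup s | x \in undup s) count_mem x s * n`!)%N; last first.
  rewrite -big_seq -big_distrl /=.
  have := perm_size (perm_count_undup s); rewrite size_flatten /shape -map_comp.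
  rewrite sumn_map Dn => H; rewrite factS -H; congr (_ * _)%N.
  by apply: eq_bigr => x _ /=; rewrite size_nseq.
apply: eq_bigr => x; rewrite mem_undup => sx.
have Dr : size (rem x s) = n by rewrite size_rem// Dn.
have := IHn _ Dr; rewrite Dr => <-; rewrite mulnA; congr (_ * _)%N.
rewrite (@prod_countE (undup s) (rem x s)) ?undup_uniq//; last first.
  by move=> y /mem_rem; rewrite mem_undup.
rewrite !(bigD1_seq x) ?undup_uniq ?mem_undup//= mulnA; congr (_ * _)%N.
  have cx : (0 < count_mem x s)%N by rewrite -has_count has_pred1.
  by rewrite count_mem_rem eqxx subn1 -{1}(prednK cx) factS prednK.
apply: eq_bigr => y /negbTE yx; rewrite count_mem_rem eq_sym yx subn0//.
Qed.

Lemma mfactE phi : mfact phi = (\prod_(x <- undup phi) (count_mem x phi)`!)%N.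
Proof.
rewrite (perm_big _ (perm_undup_mset phi)) /=; apply: eq_bigr => x _.
by rewrite count_mem_mset.
Qed.

Lemma mfact_gt0 phi : (0 < mfact phi)%N.
Proof. by rewrite prodn_gt0// => x; rewrite fact_gt0. Qed.

Lemma seq_msetE phi s : (seq_mset s == phi) = (s \in permutations phi).
Proof.
rewrite mem_permutations; apply/eqP/idP => [<-|].
  by rewrite perm_sym perm_eq_seq_mset.
by move=> /eq_seq_msetP->; rewrite seq_mset_id.
Qed.

End Multisets.

Definition acc (K : nat) (X : choiceType) (t : K.-tuple X) : msetK K X :=
  Sub (seq_mset t) (introT eqP (etrans (msize_seq t) (size_tuple t))).

Section Arrangements.
Variables (K : nat) (X : choiceType).
Implicit Types phi : msetK K X.

Definition arrangements phi : seq (K.-tuple X) :=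
  pmap insub (permutations (val phi)).

Lemma acc_eq phi (t : K.-tuple X) : (acc t == phi) = (t \in arrangements phi).
Proof. by rewrite -val_eqE /= seq_msetE mem_pmap_sub. Qed.

Lemma uniq_arrangements phi : uniq (arrangements phi).
Proof. by apply: pmap_sub_uniq; exact: permutations_uniq. Qed.

Lemma size_arrangements phi :
  (mfact (val phi) * size (arrangements phi) = K`!)%N.
Proof.
have sK : size (val phi : {mset X}) = K by rewrite -msizeE; exact/eqP/(valP phi).
rewrite -[in RHS]sK -size_permutations_fact mfactE; congr (_ * _)%N.
rewrite size_pmap_sub; apply/eqP; rewrite -all_count; apply/allP => s.
by rewrite mem_permutations => /perm_size /= ->; rewrite sK.
Qed.

Lemma arr_is_dist (R : realType) phi :
  is_dist (fun t : K.-tuple X =>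
    if acc t == phi then (mfact (val phi))%:R / K`!%:R else 0 : R).
Proof.
apply: (is_dist_seq (uniq_arrangements phi)) => [t|t|].
- by case: ifP => // _; rewrite divr_ge0.
- by rewrite acc_eq; case: ifP => //; rewrite eqxx.
rewrite (eq_big_seq (fun=> (mfact (val phi))%:R / K`!%:R)); last first.
  by move=> t; rewrite -acc_eq => ->.
rewrite big_const_seq count_predT iter_addr_0 -[LHS]mulr_natr mulrAC.
by rewrite -natrM size_arrangements divff// pnatr_eq0 -lt0n fact_gt0.
Qed.

End Arrangements.

Definition arr (R : realType) (K : nat) (X : choiceType) :
    channel R (msetK K X) (K.-tuple X) := fun phi =>
  @Dist R (K.-tuple X)
    (fun t => if acc t == phi then (mfact (val phi))%:R / K`!%:R else 0)
    (arr_is_dist R phi).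

Definition chan_pow (R : realType) (K : nat) (X Y : choiceType)
    (c : channel R X Y) : channel R (K.-tuple X) (K.-tuple Y) := fun t =>
  @Dist R (K.-tuple Y) (fun u => \prod_(i < K) c (tnth t i) (tnth u i))
    (iprod_is_dist (fun i => c (tnth t i))).
Arguments chan_pow {R} K {X Y} c _.

Definition Mchan (R : realType) (K : nat) (X Y : choiceType)
    (c : channel R X Y) : channel R (msetK K X) (msetK K Y) :=
  kcomp (fchan R (@acc K Y)) (kcomp (chan_pow K c) (@arr R K X)).
Arguments Mchan {R} K {X Y} c _.

Lemma mn_is_dist (R : realType) (K : nat) (X : choiceType) (w : dist R X) :
  is_dist (fun phi : msetK K X => K`!%:R / (mfact (val phi))%:R *
    \prod_(x <- finsupp (val phi)) w x ^+ (val phi) x).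
Proof.
pose c : channel R unit X := fun=> w.
apply: (@is_dist_eq _ _ _
  (push (fchan R (@acc K X)) (chan_pow K c [tuple of nseq K tt]))) => phi /=.
rewrite (@fsumE _ _ _ (arrangements phi)) ?uniq_arrangements//; last first.
  move=> t; rewrite -acc_eq [phi == _]eq_sym; case: (acc t == phi) => //=.
  by rewrite mulr0n mulr0 eqxx.
rewrite -(size_arrangements phi) natrM [_%:R * _%:R]mulrC mulfK; last first.
  by rewrite pnatr_eq0 -lt0n mfact_gt0.
rewrite mulr_natl -iter_addr_0 -count_predT -big_const_seq /= big_seq [RHS]big_seq.
apply: eq_bigr => t; rewrite -acc_eq => /eqP <-; rewrite eqxx mulr1.
rewrite -(big_tuple _ _ t xpredT w) /=.
rewrite -(perm_big _ (perm_eq_seq_mset t)) /= big_mset.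
by apply: eq_bigr.
Qed.

Definition mn (R : realType) (K : nat) (X : choiceType) (w : dist R X) :
    dist R (msetK K X) :=
  @Dist R (msetK K X)
    (fun phi => K`!%:R / (mfact (val phi))%:R *
       \prod_(x <- finsupp (val phi)) w x ^+ (val phi) x)
    (mn_is_dist K w).

Lemma flrn_is_dist (R : realType) (K : nat) (X : choiceType) (hK : (0 < K)%N)
    (phi : msetK K X) :
  is_dist (fun x => (val phi x)%:R / (msize (val phi))%:R : R).
Proof.
apply: (@is_dist_seq _ _ _ (finsupp (val phi))); rewrite ?fset_uniq//.
- by move=> x; rewrite divr_ge0.
- by move=> x; rewrite mem_finsupp; apply: contraNneq => ->; rewrite mul0r.
- rewrite -mulr_suml -natr_sum -/(msize (val phi)) (eqP (valP phi)).
  by rewrite divff// pnatr_eq0 -lt0n.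
Qed.

Definition flrn (R : realType) (K : nat) (X : choiceType) (hK : (0 < K)%N) :
    channel R (msetK K X) X := fun phi =>
  @Dist R X (fun x => (val phi x)%:R / (msize (val phi))%:R)
    (flrn_is_dist R hK phi).
Arguments flrn {R K X} hK _.

Record predicate (R : realType) (A : choiceType) := Predicate {
  pred_fun :> A -> R;
  pred_ge0 : forall a, 0 <= pred_fun a;
  pred_le1 : forall a, pred_fun a <= 1 }.

Lemma point_le1 (R : realType) (A : choiceType) (a b : A) :
  ((b == a)%:R : R) <= 1.
Proof. by case: (b == a). Qed.

Definition point_pred (R : realType) (A : choiceType) (a : A) : predicate R A :=
  @Predicate R A (fun b => (b == a)%:R) (fun b => ler0n R (b == a))
    (@point_le1 R A a).

Definition validity (R : realType) (A : choiceType) (s : dist R A)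
  (p : predicate R A) : R := \sum_(a \in [set: A]) s a * p a.

Lemma validity_ge0 (R : realType) (A : choiceType) (s : dist R A)
  (p : predicate R A) : 0 <= validity s p.
Proof. by apply: fsumr_ge0 => a _; rewrite mulr_ge0 ?dist_ge0 ?pred_ge0. Qed.

Lemma validity_le1 (R : realType) (A : choiceType) (s : dist R A)
  (p : predicate R A) : validity s p <= 1.
Proof.
rewrite /validity expect_supp.
rewrite -(@sum_dist _ _ s (supp s)) ?fset_uniq//; last first.
  by move=> x; rewrite suppP.
by apply: ler_sum => a _; rewrite ler_piMr ?dist_ge0 ?pred_le1.
Qed.

Definition pullback (R : realType) (A B : choiceType) (d : channel R A B)
    (q : predicate R B) : predicate R A :=
  @Predicate R A (fun a => \sum_(b \in [set: B]) d a b * q b)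
    (fun a => validity_ge0 (d a) q) (fun a => validity_le1 (d a) q).

Lemma cond_is_dist (R : realType) (A : choiceType) (s : dist R A)
    (p : predicate R A) (hp : validity s p != 0) :
  is_dist (fun a => s a * p a / validity s p).
Proof.
split=> [a| |].
- by rewrite divr_ge0 ?validity_ge0// mulr_ge0 ?dist_ge0 ?pred_ge0.
- apply: sub_finite_set (dist_fin s) => a /=.
  by apply: contraNneq => ->; rewrite !mul0r.
- by rewrite -mulr_fsuml divff.
Qed.

Definition cond (R : realType) (A : choiceType) (s : dist R A)
    (p : predicate R A) (hp : validity s p != 0) : dist R A :=
  @Dist R A (fun a => s a * p a / validity s p) (cond_is_dist hp).

Lemma dagger_is_dist (R : realType) (X Y : choiceType) (c : channel R X Y)
    (w : dist R X) (y : Y) :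
  is_dist (fun x => if push c w y == 0 then w x
                    else w x * c x y / push c w y).
Proof.
case: eqP => [_|/eqP cwy]; first exact: distP.
split=> [x| |].
- by rewrite divr_ge0 ?dist_ge0// mulr_ge0 ?dist_ge0.
- apply: sub_finite_set (dist_fin w) => x /=.
  by apply: contraNneq => ->; rewrite !mul0r.
- by rewrite -mulr_fsuml divff.
Qed.

(* The Bayesian inverse is only determined at the y with (c_* w)(y) <> 0; at   *)
(* the other points of Y, where the quotient is undefined, the value is set to *)
(* w so that the result is a channel defined on all of Y.                      *)
Definition dagger (R : realType) (X Y : choiceType) (c : channel R X Y)
    (w : dist R X) : channel R Y X := fun y =>
  @Dist R X (fun x => if push c w y == 0 then w x
                      else w x * c x y / push c w y)
    (dagger_is_dist c w y).

(* Main.v *)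
(** Reading a multiset as a uniformly random arrangement turns the multinomial
    [mn K omega] into [K] independent draws from [omega].  Hence, for every [f],
    the expectation of [f] weighted by the probability of observing [psi] is
    [\sum_u \sum_t \prod_i omega (t i) * c (t i) (u i) * f (acc t)], with [u]
    ranging over the arrangements of [psi].  With [f = 1] the sum over [t]
    factors into [P = \prod_i (push c omega) (u i)], which does not depend on
    [u].  With [f = flrn _ x], a mean of the indicators of [t j = x], the [j]th
    factor is replaced by [omega x * c x (u j)], i.e. [P] is multiplied by
    [dagger c omega (u j) x]; averaging over [j] is Jeffrey's update. *)
Require Import Defs.
From mathcomp Require Import all_boot all_order all_algebra finmap multiset.
From mathcomp Require Import boolp classical_sets functions cardinality fsbigop.
From mathcomp Require Import reals.

Set Implicit Arguments.
Unset Strict Implicit.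
Unset Printing Implicit Defensive.

Import Order.TTheory GRing.Theory Num.Theory.
Local Open Scope classical_set_scope.
Local Open Scope ring_scope.

Definition expect (R : realType) (X : choiceType) (d : dist R X) (q : X -> R) :=
  \sum_(x \in [set: X]) d x * q x.

Section Expectation.
Variable R : realType.
Implicit Types X Y : choiceType.

Lemma eq_expect X (d : dist R X) (f g : X -> R) :
  (forall x, d x != 0 -> f x = g x) -> expect d f = expect d g.
Proof.
move=> fg; apply: eq_fsbigr => x _; have [->|/fg-> //] := eqVneq (d x) 0.
by rewrite !mul0r.
Qed.

Lemma expectZ X (d : dist R X) (k : R) (f : X -> R) :
  expect d (fun x => k * f x) = k * expect d f.
Proof.
rewrite /expect !expect_supp mulr_sumr; apply: eq_bigr => x _.
by rewrite mulrCA.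
Qed.

Lemma expect_sum X (I : Type) (r : seq I) (d : dist R X) (f : I -> X -> R) :
  expect d (fun x => \sum_(i <- r) f i x) = \sum_(i <- r) expect d (f i).
Proof.
rewrite /expect expect_supp.
under eq_bigr do rewrite mulr_sumr.
rewrite exchange_big /=; apply: eq_bigr => i _.
by rewrite expect_supp.
Qed.

Lemma expect_point X (d : dist R X) (x : X) :
  expect d (fun y => (y == x)%:R) = d x.
Proof.
rewrite /expect (@fsumE _ _ _ [:: x])//; first by rewrite big_seq1 eqxx mulr1.
move=> y; rewrite inE; apply: contraNT => /negbTE ->.
by rewrite mulr0n mulr0.
Qed.

Lemma expect_dirac X (x : X) (q : X -> R) : expect (dirac R x) q = q x.
Proof.
rewrite /expect (@fsumE _ _ _ [:: x])//; first by rewrite big_seq1 /= eqxx mul1r.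
move=> y; rewrite inE /=; apply: contraNT => /negbTE ->.
by rewrite mulr0n mul0r.
Qed.

(** Finite supports let the two summations be exchanged; the pushforward can then be peeled off one
    channel at a time. *)
Lemma expect_push X Y (c : channel R X Y) (w : dist R X) (q : Y -> R) :
  expect (push c w) q = expect w (fun x => expect (c x) q).
Proof.
have pushE y : push c w y * q y = \sum_(x <- supp w) w x * c x y * q y.
  by rewrite /= expect_supp mulr_suml.
rewrite {1}/expect expect_supp.
under eq_bigr do rewrite pushE.
rewrite exchange_big /= [RHS]expect_supp big_seq [RHS]big_seq.
apply: eq_bigr => x; rewrite suppP => wx.
under eq_bigr do rewrite -mulrA.
(* The support of [push c w] contains that of [c x]: where [c x y != 0], the sum defining
   [push c w y] has nonnegative terms and a positive one at [x]. *)
rewrite -mulr_sumr; congr (_ * _); apply/esym/fsumE => // y.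
rewrite suppP /= mulf_eq0 negb_or => /andP[cxy _].
have wc0 z : 0 <= w z * c z y by rewrite mulr_ge0 ?dist_ge0.
rewrite gt_eqF// expect_supp (bigD1_seq x) ?fset_uniq ?suppP//=.
rewrite ltr_pwDl ?sumr_ge0// lt_def wc0 andbT.
by rewrite mulf_neq0.
Qed.

Lemma expect_cond X (s : dist R X) (p : predicate R X)
    (hp : validity s p != 0) (f : X -> R) :
  expect (cond hp) f = expect s (fun a => p a * f a) / validity s p.
Proof.
rewrite /expect mulr_fsuml; apply: eq_fsbigr => a _ /=.
by rewrite mulrAC !mulrA.
Qed.

End Expectation.

(** The common finite set [S] reduces the tuples to finite functions ['I_K -> S], where products
    distribute over sums. *)
Lemma fsum_prod_tuple (R : realType) (X : choiceType) (K : nat)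
    (f : 'I_K -> X -> R) (S : {fset X}) :
    (forall i x, f i x != 0 -> x \in S) ->
  \sum_(t \in [set: K.-tuple X]) \prod_(i < K) f i (tnth t i)
  = \prod_(i < K) \sum_(x \in [set: X]) f i x.
Proof.
move=> fS.
pose tup (g : {ffun 'I_K -> S}) : K.-tuple X := [tuple val (g i) | i < K].
have tup_inj : injective tup.
  move=> g h /(congr1 (fun t => tnth t)) gh; apply/ffunP => i; apply: val_inj.
  by have := congr1 (@^~ i) gh; rewrite /= !tnth_mktuple.
rewrite (@fsumE _ _ _ (map tup (enum {: {ffun 'I_K -> S}}))); last first.
- move=> t /prodf_neq0 ft.
  have tS i : tnth t i \in S by apply: (fS i); exact: ft.
  apply/mapP; exists [ffun i => [` tS i]%fset]; first by rewrite mem_enum.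
  by apply: eq_from_tnth => i; rewrite tnth_mktuple ffunE.
- by rewrite map_inj_uniq ?enum_uniq.
rewrite big_map big_enum /=.
under eq_bigr do under eq_bigr do rewrite tnth_mktuple.
rewrite -(bigA_distr_bigA (fun i (x : S) => f i (val x))).
apply: eq_bigr => i _; rewrite -(big_seq_fsetE _ _ xpredT (f i)) /=.
by rewrite (fsumE (fset_uniq S)) // => x; exact: fS.
Qed.

Section Arrangements.
Variables (R : realType) (K : nat).
Implicit Types X Y : choiceType.

Definition iid X (w : dist R X) : dist R (K.-tuple X) :=
  @Dist R _ _ (iprod_is_dist (fun _ : 'I_K => w)).

Lemma prod_acc X (t : K.-tuple X) (h : X -> R) :
  \prod_(x <- finsupp (val (acc t))) h x ^+ (val (acc t)) x
  = \prod_(i < K) h (tnth t i).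
Proof.
rewrite -(big_tuple _ _ t xpredT h) -(perm_big _ (perm_eq_seq_mset t)) /=.
by rewrite big_mset; apply: eq_bigr.
Qed.

Lemma sum_acc X (t : K.-tuple X) (h : X -> R) :
  \sum_(x <- finsupp (val (acc t))) (val (acc t) x)%:R * h x
  = \sum_(i < K) h (tnth t i).
Proof.
rewrite -(big_tuple _ _ t xpredT h) -(perm_big _ (perm_eq_seq_mset t)) /=.
rewrite big_mset; apply: eq_bigr => x _.
by rewrite mulr_natl.
Qed.

(** Drawing from the frequencies of [acc t] amounts to choosing a position of [t] uniformly. *)
Lemma expect_flrn_acc X (hK : (0 < K)%N) (t : K.-tuple X) (h : X -> R) :
  expect (flrn hK (acc t)) h = K%:R^-1 * \sum_(i < K) h (tnth t i).
Proof.
rewrite /expect (@fsumE _ _ _ (finsupp (val (acc t)))) ?fset_uniq//; last first.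
  move=> x; rewrite mem_finsupp; apply: contraNneq => /= ->.
  by rewrite !mul0r.
rewrite -sum_acc mulr_sumr; apply: eq_bigr => x _ /=.
by rewrite (eqP (valP (acc t))) mulrAC mulrC.
Qed.

(** The multinomial coefficient and the uniform weight of an arrangement are inverse to each other,
    which leaves only the product of the [w (tnth t i)]. *)
Lemma push_arr_mn X (w : dist R X) : push (@arr R K X) (mn K w) = iid w.
Proof.
apply: dist_ext => t.
(* Only the multiset [acc t] has [t] among its arrangements. *)
rewrite [LHS](_ : _ = mn K w (acc t) * arr R (acc t) t); last first.
  rewrite /= (@fsumE _ _ _ [:: acc t]) ?big_seq1// => phi.
  by rewrite inE [phi == _]eq_sym; case: (acc t == phi) => //; rewrite mulr0 eqxx.
rewrite /= eqxx prod_acc mulrAC [X in X * _](_ : _ = 1) ?mul1r//.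
rewrite mulrA divfK ?divff// pnatr_eq0 -lt0n ?fact_gt0//.
exact: mfact_gt0.
Qed.

Lemma pullback_Mchan_point X Y (c : channel R X Y) (psi : msetK K Y)
    (phi : msetK K X) :
  pullback (Mchan K c) (point_pred R psi) phi
  = expect (arr R phi) (fun t => \sum_(u <- arrangements psi) chan_pow K c t u).
Proof.
rewrite [LHS]expect_push expect_push; apply: eq_expect => t _.
transitivity (expect (chan_pow K c t) (fun u => (acc u == psi)%:R)).
  by apply: eq_expect => u _; rewrite expect_dirac.
rewrite /expect (@fsumE _ _ _ (arrangements psi)) ?uniq_arrangements//.
  rewrite big_seq [RHS]big_seq; apply: eq_bigr => u.
  by rewrite -acc_eq => ->; rewrite mulr1.
move=> u; rewrite -acc_eq; case: (acc u == psi) => //.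
by rewrite mulr0n mulr0 eqxx.
Qed.

Lemma expect_mn_pullback X Y (c : channel R X Y) (w : dist R X)
    (psi : msetK K Y) (f : msetK K X -> R) :
  expect (mn K w)
    (fun phi => pullback (Mchan K c) (point_pred R psi) phi * f phi)
  = \sum_(u <- arrangements psi)
      expect (iid w) (fun t => chan_pow K c t u * f (acc t)).
Proof.
rewrite -expect_sum -push_arr_mn expect_push.
apply: eq_expect => phi _; rewrite pullback_Mchan_point mulrC -expectZ.
(* On the support of [arr R phi] one has [acc t = phi], so [f phi] may be replaced by
   [f (acc t)]. *)
apply: eq_expect => t /=; case: (acc t =P phi) => [->|]; last by rewrite eqxx.
by move=> _; rewrite -mulr_suml mulrC.
Qed.

Lemma expect_iid_prod X (w : dist R X) (f : 'I_K -> X -> R) :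
  expect (iid w) (fun t => \prod_(i < K) f i (tnth t i))
  = \prod_(i < K) expect w (f i).
Proof.
rewrite -(@fsum_prod_tuple R X K (fun i x => w x * f i x) (supp w)).
  by apply: eq_fsbigr => t _; rewrite -big_split.
by move=> i x; rewrite suppP mulf_eq0 negb_or => /andP[].
Qed.

Lemma expect_iid_chan_pow X Y (c : channel R X Y) (w : dist R X)
    (u : K.-tuple Y) :
  expect (iid w) (fun t => chan_pow K c t u)
  = \prod_(i < K) push c w (tnth u i).
Proof. exact: (expect_iid_prod w (fun i x => c x (tnth u i))). Qed.

Lemma expect_iid_chan_pow_point X Y (c : channel R X Y) (w : dist R X)
    (u : K.-tuple Y) (j : 'I_K) (x : X) :
    (forall i, push c w (tnth u i) != 0) ->
  expect (iid w) (fun t => chan_pow K c t u * (tnth t j == x)%:R)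
  = (\prod_(i < K) push c w (tnth u i)) * dagger c w (tnth u j) x.
Proof.
move=> cw0.
(* The indicator is absorbed into factor [j] so that the integrand is a product over positions and
   independence applies. *)
transitivity (expect (iid w) (fun t => \prod_(i < K)
    (c (tnth t i) (tnth u i) * (if i == j then (tnth t i == x)%:R else 1)))).
  apply: eq_expect => t _; rewrite big_split /=; congr (_ * _).
  by rewrite -big_mkcond big_pred1_eq.
rewrite (expect_iid_prod w (fun i x' =>
  c x' (tnth u i) * (if i == j then (x' == x)%:R else 1))).
rewrite (bigD1 j)//= [in RHS](bigD1 j)//= mulrAC; congr (_ * _).
  (* [cw0 j] selects the quotient branch of [dagger], whose denominator cancels factor [j]. *)
  rewrite (negbTE (cw0 j)) mulrCA divff ?cw0// mulr1 eqxx.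
  rewrite mulrC -[w x]expect_point -expectZ; apply: eq_expect => x' _.
  by case: eqP => [->//|]; rewrite !mulr0.
apply: eq_bigr => i /negbTE ->; apply: eq_expect => x' _.
by rewrite mulr1.
Qed.

End Arrangements.

Theorem theorem8p3 (R : realType) (X Y : choiceType) (c : channel R X Y)
  (omega : dist R X) (K : nat) (hK : (1 <= K)%N) (psi : msetK K Y)
  (hval : validity (mn K omega) (pullback (Mchan K c) (point_pred R psi)) != 0) :
  push (flrn hK) (cond hval) = push (dagger c omega) (flrn hK psi).
Proof.
(* [P] depends on the multiset alone, so all arrangements of [psi] share it as their likelihood. *)
pose P : R := \prod_(y <- finsupp (val psi)) push c omega y ^+ val psi y.
have accP u : u \in arrangements psi -> acc u = psi.
  by rewrite -acc_eq => /eqP.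
have PE u : u \in arrangements psi -> \prod_(i < K) push c omega (tnth u i) = P.
  by move=> /accP upsi; rewrite /P -upsi prod_acc.
have sumP : \sum_(u <- arrangements psi) P = P *+ size (arrangements psi).
  by rewrite big_const_seq count_predT iter_addr_0.
have valE : validity (mn K omega) (pullback (Mchan K c) (point_pred R psi))
    = P *+ size (arrangements psi).
  transitivity (expect (mn K omega) (fun phi =>
      pullback (Mchan K c) (point_pred R psi) phi * 1)).
    by apply: eq_expect => phi _; rewrite mulr1.
  rewrite (expect_mn_pullback c omega psi (fun=> 1)) -sumP.
  rewrite big_seq [RHS]big_seq; apply: eq_bigr => u /PE <-.
  rewrite -expect_iid_chan_pow; apply: eq_expect => t _.
  by rewrite mulr1.
have P0 : P != 0.
  by apply: contraNneq hval => P0; rewrite valE P0 mul0rn.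
apply: dist_ext => x.
rewrite [LHS]expect_cond expect_mn_pullback; apply: (mulIf hval).
(* With the validity spread out as one [P] per arrangement, both sides are compared arrangement by
   arrangement. *)
rewrite divfK// valE -sumP mulr_sumr big_seq [RHS]big_seq.
(* Since [P != 0], every observed point has nonzero predicted probability, so the default value of
   [dagger] never occurs. *)
apply: eq_bigr => u uA; have cw0 i : push c omega (tnth u i) != 0.
  by move: P0; rewrite -(PE u uA) => /prodf_neq0; exact.
(* Reading [psi] as [acc u] turns Jeffrey's update into an average of [dagger] over the positions of
   [u]. *)
rewrite -(accP u uA) [push _ _ x]expect_flrn_acc -(PE u uA).
transitivity (expect (iid K omega) (fun t => K%:R^-1 *
    \sum_(j < K) chan_pow K c t u * (tnth t j == x)%:R)).
  apply: eq_expect => t _; rewrite -[flrn _ _ x]expect_point expect_flrn_acc.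
  by rewrite mulrCA mulr_sumr.
rewrite expectZ expect_sum -mulrA; congr (_ * _); rewrite mulr_suml.
by apply: eq_bigr => j _; rewrite expect_iid_chan_pow_point// mulrC.
Qed.
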